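(* Let $G=(V,E)$ be a directed graph, let $H$ be a maximal eulerian subgraph of $G$, and let $r:V\to\mathbb{Z}$ be a rank function conforming $H$. Assume that there is an edge $(p,s)\in E(H)$ with $\mathrm{slack}((p,s),r)>0$, and let $(H',r')$ be the output of $\mathrm{Relief}(H,r,G,p,s)$. Then $H'$ is a maximal eulerian subgraph of $G$, $r'$ conforms $H'$, $$\max_{e\in E(H')}\mathrm{slack}(e,r')\le\max_{e\in E(H)}\mathrm{slack}(e,r),$$ and $$\left|\{e\in E(H') : \mathrm{slack}(e,r')>0\}\right|<\left|\{e\in E(H) : \mathrm{slack}(e,r)>0\}\right|.$$
   Context: Graphs are finite and directed; subgraphs of $G=(V,E)$ are taken on the same vertex set $V$, and $E(H)$ is the edge set of $H$. A rank function is a map $r:V\to\mathbb{Z}$. An edge $(u,v)$ is forward w.r.t. $r$ if $r(u)<r(v)$ and backward if $r(u)\ge r(v)$. Slack: $\mathrm{slack}((u,v),r)=\max(r(v)-r(u)-1,0)$. A graph is eulerian if every vertex has in-degree equal to out-degree (connectivity is not required). A subgraph $H$ of $G$ is a maximal eulerian subgraph if it is eulerian and no eulerian subgraph of $G$ has an edge set strictly containing $E(H)$. A rank function $r$ conforms $H$ if all edges of $G$ that are backward w.r.t. $r$ lie in $E(H)$. Algorithm Relief$(H,r,G,p,s)$. Input: a graph $G=(V,E)$, a maximal eulerian subgraph $H$, a rank function $r$ conforming $H$, and an edge $(p,s)\in E(H)$ with $\mathrm{slack}((p,s),r)>0$. (1) Set $F:=E(H)$, $r':=r$, $t(v):=0$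 for all $v\in V$; then set $t(p):=r(s)-r(p)-1$ and let $S$ be a priority queue (largest priority first) containing only $p$, with priority $t(p)$. (2) While $S$ is not empty: pop a vertex $u$ of highest priority from $S$ and set $r'(u):=r'(u)+t(u)$. For each $(u,v)\in E\setminus F$ with $r'(v)\le r'(u)$: let $t:=r'(u)+1-r'(v)$; if $t>t(v)$, set $t(v):=t$, add $v$ to $S$ with priority $t$ (updating its priority if $v$ is already in $S$), and set $\mathrm{parent}(v):=u$. Then for each $e=(w,u)\in F$ with $\mathrm{slack}(e,r')>\mathrm{slack}(e,r)$: let $t:=\mathrm{slack}(e,r')-\mathrm{slack}(e,r)$; if $t>t(w)$, set $t(w):=t$, add $w$ to $S$ with priority $t$ (updating its priority if $w$ is already in $S$), and set $\mathrm{parent}(w):=u$. (3) After the loop, if $\mathrm{slack}((p,s),r')>0$: let $O$ be the set of edges of $E$ along the path from $s$ to $p$ obtained by following the parent links (for each vertex $x\ne p$ on this path, the edge joining $x$ and $\mathrm{parent}(x)$ is the one that was being processed when $\mathrm{parent}(x)$ was last set); replace $F$ by $(F\setminus O)\cup(O\setminus F)$ and then delete $(p,s)$ from $F$. (4) Return $H'=(V,F)$ and $r'$. *)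

(* Defs.v *)
From HB Require Import structures.
From mathcomp Require Import all_boot all_order all_algebra.

Set Implicit Arguments.
Unset Strict Implicit.
Unset Printing Implicit Defensive.

Import Order.TTheory GRing.Theory Num.Theory.

Local Open Scope ring_scope.

(* A directed graph on the finite vertex set V is given by
   its edge set E : {set V * V}; the edge (u, v) goes from u to v, loops and
   antiparallel pairs are allowed.  A subgraph keeps the vertex set V, hence
   is a subset of E. *)

Section Graphs.

Variable V : finType.
Implicit Types (E H K : {set V * V}) (r : V -> int) (e : V * V).

Definition indegree E (v : V) : nat := #|[set e in E | e.2 == v]|.
Definition outdegree E (v : V) : nat := #|[set e in E | e.1 == v]|.

Definition eulerian E : Prop := forall v : V, indegree E v = outdegree E v.

Definition maximal_eulerian E H : Prop :=
  [/\ H \subset E, eulerian H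
    & ~ exists K, [/\ K \subset E, eulerian K & H \proper K]].

Definition backward r e : bool := r e.2 <= r e.1.

Definition conforms E H r : Prop :=
  forall e, e \in E -> backward r e -> e \in H.

Definition slack e r : int := Num.max (r e.2 - r e.1 - 1) 0.

(* Slacks are nonnegative, so the default value 0 is only visible when H has
   no edge. *)
Definition max_slack H r : int := \big[Num.max/0]_(e in H) slack e r.

Definition num_slack H r : nat := #|[set e in H | 0 < slack e r]|.

End Graphs.

Section Relief.

Variable V : finType.

(* The variables r', t, S and parent of the algorithm.  The priority queue S
   maps each vertex it contains to its priority, and any other vertex to None.
   A parent link stores the parent together with the edge that was being
   processed when the link was set: the parent alone does not determine the
   edge when E contains an antiparallel pair. *)
Record relief_state := ReliefState {
  rank : V -> int;
  shift : V -> int;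
  queue : V -> option int;
  parent : V -> option (V * (V * V))
}.

Implicit Types (E H O : {set V * V}) (r : V -> int) (e : V * V).
Implicit Types (u v x : V) (st : relief_state).

Definition relief_init r (p s : V) : relief_state :=
  let t := r s - r p - 1 in
  {| rank := r;
     shift := [eta (fun=> 0) with p |-> t];
     queue := [eta (fun=> None) with p |-> Some t];
     parent := fun=> None |}.

Definition raise_shift st x (t : int) u e : relief_state :=
  if shift st x < t then
    {| rank := rank st;
       shift := [eta shift st with x |-> t];
       queue := [eta queue st with x |-> Some t];
       parent := [eta parent st with x |-> Some (u, e)] |}
  else st.

Definition pop st u : relief_state :=
  {| rank := [eta rank st with u |-> rank st u + shift st u];
     shift := shift st;
     queue := [eta queue st with u |-> None];
     parent := parent st |}.

Definition highest_priority st u : Prop :=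
  exists2 k : int, queue st u = Some k
    & forall v (l : int), queue st v = Some l -> l <= k.

Definition process_out u st e : relief_state :=
  raise_shift st e.2 (rank st u + 1 - rank st e.2) u e.

Definition process_in r u st e : relief_state :=
  raise_shift st e.1 (slack e (rank st) - slack e r) u e.

(* The edges selected by the two inner loops, F being E(H) throughout the
   while loop; r' is not modified by the inner loops, so the selection can be
   made before running them. *)
Definition out_edges E H (r' : V -> int) u : {set V * V} :=
  [set e in E :\: H | (e.1 == u) && (r' e.2 <= r' u)].

Definition in_edges H r (r' : V -> int) u : {set V * V} :=
  [set e in H | (e.2 == u) && (slack e r < slack e r')].

(* One iteration of the while loop.  Neither the tie-breaking between vertices
   of highest priority nor the order in which the inner loops enumerate their
   edges is prescribed. *)
Definition relief_step E H r st st' : Prop :=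
  exists (u : V) (es fs : seq (V * V)),
    [/\ highest_priority st u,
        perm_eq es (enum (out_edges E H (rank (pop st u)) u)),
        perm_eq fs (enum (in_edges H r (rank (pop st u)) u))
      & st' = foldl (process_in r u) (foldl (process_out u) (pop st u) es) fs].

Inductive relief_loop E H r : relief_state -> relief_state -> Prop :=
| ReliefLoopDone st :
    (forall v, queue st v = None) -> relief_loop E H r st st
| ReliefLoopStep st st1 st2 :
    relief_step E H r st st1 -> relief_loop E H r st1 st2 ->
    relief_loop E H r st st2.

(* parent_path par p x O: following the links par from x leads to p, and O is
   the set of edges attached to the links that are followed. *)
Inductive parent_path (par : V -> option (V * (V * V))) (p : V) :
    V -> {set V * V} -> Prop :=
| ParentPathEnd : parent_path par p p set0
| ParentPathLink x y e O :
    x != p -> par x = Some (y, e) -> parent_path par p y O ->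
    parent_path par p x (e |: O).

(* relief E H r p s H' r': (H', r') is an output of Relief(H, r, (V, E), p, s).
   The preconditions on the input are not part of the relation. *)
Inductive relief E H r (p s : V) : {set V * V} -> (V -> int) -> Prop :=
| ReliefKeep st :
    relief_loop E H r (relief_init r p s) st ->
    ~~ (0 < slack (p, s) (rank st)) ->
    relief E H r p s H (rank st)
| ReliefReroute st O :
    relief_loop E H r (relief_init r p s) st ->
    0 < slack (p, s) (rank st) ->
    parent_path (parent st) p s O ->
    relief E H r p s (((H :\: O) :|: (O :\: H)) :\ (p, s)) (rank st).

End Relief.

(* Main.v *)
(* Call residual arcs the edges outside H, traversed forwards, and the edges of
   H, traversed backwards.  Each arc has a cost, nonnegative because r conforms
   H, such that processing an arc from u to x asks x to be raised by the shift
   of u minus that cost, whichever kind of edge it comes from.  Relief is thus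
   Dijkstra's algorithm: vertices are popped once, in nonincreasing order of
   shifts, and at the end no arc asks for more than its target was raised by.
   So edges outside H remain forward and no slack in H has increased.  If
   (p, s) still has positive slack then s was raised, and the parent links from
   s form a residual path from p to s whose arcs are tight; flipping it and
   deleting (p, s) is the augmentation of a circulation along a cycle.  Edges
   that enter H have slack 0 and those that leave it are forward.  Finally, an
   eulerian subgraph is maximal as soon as some rank function conforms it. *)

Require Import Defs.
From HB Require Import structures.
From mathcomp Require Import all_boot all_order all_algebra.
From mathcomp Require Import zify.

Set Implicit Arguments.
Unset Strict Implicit.
Unset Printing Implicit Defensive.

Import Order.TTheory GRing.Theory Num.Theory.

Local Open Scope ring_scope.

(** * Circulations and maximality of eulerian subgraphs *)

Section Circulations.

Variable V : finType.
Implicit Types (E H K O : {set V * V}) (r : V -> int) (e : V * V) (v : V).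

Definition net e v : int := (e.1 == v)%:R - (e.2 == v)%:R.

Lemma eulerianP K :
  eulerian K <-> (forall v, \sum_(e in K) net e v = 0).
Proof.
have degE (f : V * V -> V) v :
    \sum_(e in K) (f e == v)%:R = #|[set e in K | f e == v]|%:R :> int.
  by rewrite -natr_sum -sum1dep_card big_mkcondr.
split=> eulK v; have := eulK v; rewrite /net sumrB !degE.
  by rewrite /indegree /outdegree => ->; rewrite subrr.
by move/eqP; rewrite subr_eq0 eqr_nat => /eqP.
Qed.

(** Grouped by vertex, [r v] is counted once per edge entering [v] and subtracted once per edge
    leaving it. *)
Lemma sum_rank_diff K r : eulerian K -> \sum_(e in K) (r e.2 - r e.1) = 0.
Proof.
have sumE (f : V * V -> V) :
    \sum_(e in K) r (f e) = \sum_v r v *+ #|[set e in K | f e == v]|.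
  rewrite (partition_big f xpredT) //=; apply: eq_bigr => v _.
  rewrite -sum1dep_card -sumrMnr; apply: eq_bigr => e /andP[_ /eqP->].
  by rewrite mulr1n.
move=> eulK; rewrite sumrB !sumE -sumrB big1 // => v _.
by have := eulK v; rewrite /indegree /outdegree => ->; rewrite subrr.
Qed.

(* The edges of an eulerian extension of H that lie outside H would form a
   nonempty circulation all of whose edges strictly increase the rank. *)
Lemma conforms_maximal E H r :
  H \subset E -> eulerian H -> conforms E H r -> maximal_eulerian E H.
Proof.
move=> sHE eulH confH; split=> // -[K [sKE eulK /properP[sHK [e0 e0K e0H]]]].
have := sum_rank_diff r eulK.
rewrite (big_setID H) /= (setIidPr sHK) (sum_rank_diff r eulH) add0r.
have diff_gt0 e : e \in K :\: H -> 0 < r e.2 - r e.1.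
  rewrite inE => /andP[eH eK]; rewrite subr_gt0 ltNge.
  by apply: contra eH; apply: confH; apply: (subsetP sKE).
have e0KH : e0 \in K :\: H by rewrite inE e0H.
rewrite (big_setD1 e0) //= => sum0.
suff sum_ge0 : 0 <= \sum_(e in (K :\: H) :\ e0) (r e.2 - r e.1).
  by have := ltr_wpDr sum_ge0 (diff_gt0 _ e0KH); rewrite sum0 ltxx.
by apply: sumr_ge0 => e /setD1P[_ /diff_gt0/ltW].
Qed.

(** The flip changes the indicator of [H] by +1 on [O :\: H] and by -1 on [O :&: H]. With [F] a net
    flow, this reduces balance after rerouting to a signed sum over the path. *)
Lemma sum_flip H O (F : V * V -> int) :
  \sum_(e in (H :\: O) :|: (O :\: H)) F e
    = \sum_(e in H) F e + \sum_(e in O) (if e \in H then - F e else F e).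
Proof.
rewrite (big_setID H) /=.
have -> : (H :\: O :|: O :\: H) :&: H = H :\: O.
  by apply/setP=> e; rewrite !inE; case: (e \in H); case: (e \in O).
have -> : (H :\: O :|: O :\: H) :\: H = O :\: H.
  by apply/setP=> e; rewrite !inE; case: (e \in H); case: (e \in O).
rewrite [\sum_(e in H) _](big_setID O) [X in _ = _ + X](big_setID H) /=.
rewrite [X in _ = _ + (X + _)](_ : _ = - \sum_(e in O :&: H) F e); last first.
  by rewrite -sumrN; apply: eq_bigr => e /setIP[_ ->].
rewrite [X in _ = _ + (_ + X)](_ : _ = \sum_(e in O :\: H) F e); last first.
  by apply: eq_bigr => e /setDP[_ /negPf->].
by rewrite [O :&: H]setIC addrACA subrr add0r.
Qed.

End Circulations.

(** * Residual arcs, their costs, and paths of parent links *)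

Section Residual.

Variables (V : finType) (E H : {set V * V}) (r : V -> int).
Implicit Types (e : V * V) (v x : V).

Definition source e : V := if e \in H then e.2 else e.1.
Definition target e : V := if e \in H then e.1 else e.2.

(* Chosen so that, when [target e] is not yet popped, both inner loops ask to
   raise it by [shift (source e) - cost e]. *)
Definition cost e : int :=
  if e \in H then slack e r - (r e.2 - r e.1 - 1) else r e.2 - r e.1 - 1.

Lemma slack_ge0 e r' : 0 <= slack e r'.
Proof. by rewrite /slack; lia. Qed.

Lemma cost_ge0 e : conforms E H r -> e \in E -> 0 <= cost e.
Proof.
move=> confH eE; rewrite /cost; case: ifPn => [_|eH].
  by rewrite /slack; lia.
have : ~~ backward r e by apply: contra eH; apply: confH.
by rewrite /backward; lia.
Qed.

(** The signed sum telescopes along the path. As [O] is a set, each followed edge must be new: [h]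
    decreases along links, so the edges further on have targets of smaller [h]. *)
Lemma sum_parent_path (par : V -> option (V * (V * V))) (h : V -> nat) p x O :
    (forall v y e, par v = Some (y, e) ->
      [/\ source e = y, target e = v & (h y < h v)%N]) ->
    parent_path par p x O ->
  (forall e, e \in O -> target e != p /\ (h (target e) <= h x)%N /\
     par (target e) = Some (source e, e)) /\
  (forall v, \sum_(e in O) (if e \in H then - net e v else net e v)
     = (p == v)%:R - (x == v)%:R).
Proof.
move=> parP; elim=> {x O} [|x y e O xNp parx _ [IHO IHsum]].
  by split=> [e|v]; rewrite ?inE // big_set0 subrr.
have [srce tgte ltyx] := parP _ _ _ parx.
split=> [f|v].
  case/setU1P=> [->|fO]; first by rewrite srce tgte.
  by have [? [? ?]] := IHO f fO; do !split=> //; lia.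
rewrite big_setU1 /= ?IHsum; last first.
  by apply/negP=> /IHO[_ []]; rewrite tgte; lia.
suff -> : (if e \in H then - net e v else net e v) = (y == v)%:R - (x == v)%:R.
  lia.
by move: srce tgte; rewrite /net /source /target; case: ifP => _ -> ->; lia.
Qed.

(** * The loop invariant and its preservation by the inner loops *)

Variables (p s : V).

(* D lists the popped vertices, oldest first, and A the edges of the inner loops
   that remain to be processed.  A vertex outside D has index [size D], so the
   index condition on parents implies that parents have been popped. *)
Record relief_inv (D : seq V) (A : seq (V * V)) (st : relief_state V) : Prop :=
  ReliefInv {
    inv_rank v : rank st v = r v + (if v \in D then shift st v else 0);
    inv_queue v : queue st v =
      if (v \notin D) && (0 < shift st v) then Some (shift st v) else None;
    inv_ge0 v : 0 <= shift st v;
    inv_root : shift st p = slack (p, s) r;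
    inv_le_root v : shift st v <= shift st p;
    inv_sorted d v : d \in D -> v \notin D -> shift st v <= shift st d;
    inv_arc e : e \in E -> e \notin A -> source e \in D ->
      shift st (source e) - cost e <= shift st (target e);
    inv_parent v y e : parent st v = Some (y, e) ->
      [/\ e \in E, source e = y, target e = v, shift st v = shift st y - cost e
        & (index y D < index v D)%N];
    inv_linked v : v != p -> 0 < shift st v -> parent st v <> None }.

Definition last_popped (D : seq V) (u : V) st : Prop :=
  u \in D /\ forall d, d \in D -> shift st u <= shift st d.

Lemma relief_init_inv :
  0 < slack (p, s) r -> relief_inv [::] [::] (relief_init r p s).
Proof.
move=> slack_ps; have slE : r s - r p - 1 = slack (p, s) r.
  by move: slack_ps; rewrite /slack /=; lia.
split=> //=.
- by move=> v; rewrite addr0.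
- by move=> v; case: eqP => //; rewrite slE slack_ps.
- by move=> v; case: eqP => //; rewrite slE ltW.
- by rewrite eqxx.
- by move=> v; rewrite eqxx; case: eqP => // _; rewrite slE ltW.
- by move=> v /negPf->.
Qed.

Hypothesis confH : conforms E H r.

(** Common core of both inner loops. The last two hypotheses isolate what depends on the kind of
    edge: a successful raise hits an unpopped vertex and makes the arc tight, and a refused one
    means that the arc is already satisfied. *)
Lemma raise_shift_inv D A st x t u e :
    relief_inv D (e :: A) st -> last_popped D u st ->
    e \in E -> source e = u -> target e = x ->
    (shift st x < t -> x \notin D /\ t = shift st u - cost e) ->
    (t <= shift st x -> shift st u - cost e <= shift st x) ->
  relief_inv D A (raise_shift st x t u e) /\
  last_popped D u (raise_shift st x t u e).
Proof.
move=> inv [uD minu] eE srce tgte raised kept; rewrite /raise_shift.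
case: ltP => [lt_t | /kept{}kept]; last first.
  split=> //; split; try by case: inv.
  move=> f fE fA; have [-> _|fe] := eqVneq f e; first by rewrite srce tgte.
  by apply: (inv_arc inv) => //; rewrite inE negb_or fe.
have [xD tE] := raised lt_t.
have ce : 0 <= cost e by apply: cost_ge0.
have neD d : d \in D -> (d == x) = false.
  by move=> dD; apply: contraNF xD => /eqP<-.
(* The root already has the largest shift, and a request never exceeds the shift of [u] since costs
   are nonnegative. *)
have xp : (p == x) = false.
  apply/eqP => px; have := inv_le_root inv u; rewrite px; lia.
have shx := inv_ge0 inv x.
split; last first.
  by split=> //= d dD; rewrite !neD //; apply: minu.
split=> /=.
- by move=> v; rewrite (inv_rank inv); case: ifP => // vD; rewrite neD.
- move=> v; case: eqP => [->|_]; last exact: (inv_queue inv).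
  by rewrite xD /= (le_lt_trans shx).
- move=> v; case: eqP => _; [lia | exact: inv_ge0 inv v].
- by rewrite xp; apply: inv_root inv.
- move=> v; rewrite xp; case: eqP => _; last exact: inv_le_root inv v.
  have := inv_le_root inv u; lia.
- move=> d v dD vD; rewrite (neD d dD); case: eqP => _.
    have := minu d dD; lia.
  exact: inv_sorted inv d v dD vD.
- move=> f fE fA fD; rewrite neD //.
  have [fe|fe] := eqVneq f e; first by rewrite fe srce tgte eqxx; lia.
  have : shift st (source f) - cost f <= shift st (target f).
    by apply: (inv_arc inv); rewrite ?inE ?negb_or ?fe.
  case: eqP => [->|//]; lia.
- move=> v y f; case: eqP => [-> [<- <-]|/eqP vx /(inv_parent inv)].
    split=> //; first by rewrite neD.
    (* The unpopped [x] has index [size D], above that of the popped [u]. *)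
    by rewrite (memNindex xD) index_mem.
  case=> fE sf tf shf ltyv; split=> //; rewrite shf neD //.
  by rewrite -index_mem (leq_trans ltyv) // index_size.
- move=> v vp; case: eqP => // _; exact: inv_linked inv v vp.
Qed.

(** If [e.2] is already popped, its shift is at least that of [u], so the request is at most minus
    the cost and raises nothing; otherwise the request is exactly [shift st u - cost H r e]. *)
Lemma process_out_inv D A st u e :
    relief_inv D (e :: A) st -> last_popped D u st ->
    e \in E :\: H -> e.1 = u ->
  relief_inv D A (process_out u st e) /\ last_popped D u (process_out u st e).
Proof.
move=> inv lastu /setDP[eE eH] e1; have [uD minu] := lastu.
have ce := cost_ge0 confH eE; rewrite /cost (negPf eH) in ce.
have shx := inv_ge0 inv e.2.
rewrite /process_out; apply: raise_shift_inv => //;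
  rewrite ?/source ?/target ?/cost (negPf eH) // !(inv_rank inv) uD -e1;
  case: ifPn => xD; rewrite ?xD.
- have := minu _ xD; rewrite -e1; lia.
- split=> //; lia.
- have := minu _ xD; rewrite -e1; lia.
- lia.
Qed.

(** Induction on the pop index: the parent was popped earlier, and its shift is positive because the
    link is tight with nonnegative cost. *)
Lemma relief_parent_path D st x :
    relief_inv D [::] st -> 0 < shift st x ->
  exists O, parent_path (parent st) p x O.
Proof.
move=> inv; have [n] := ubnP (index x D); elim: n x => // n IH x ltxn shx.
have [->|xp] := eqVneq x p; first by exists set0; constructor.
case parx: (parent st x) (inv_linked inv xp shx) => [[y e]|//] _.
have [eE _ _ shxE ltyx] := inv_parent inv parx.
have [||O pathO] := IH y.
- exact: leq_trans ltyx _.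
- have := cost_ge0 confH eE; lia.
by exists (e |: O); apply: ParentPathLink parx pathO.
Qed.

Hypothesis sHE : H \subset E.

(** For a popped [e.1], the slack has not grown. For an unpopped one, the truncation at 0 in the new
    slack may alter the request, but a request that beats the nonnegative shift of [e.1] is not
    truncated. *)
Lemma process_in_inv D A st u e :
    relief_inv D (e :: A) st -> last_popped D u st ->
    e \in H -> e.2 = u ->
  relief_inv D A (process_in r u st e) /\ last_popped D u (process_in r u st e).
Proof.
move=> inv lastu eH e2; have [uD minu] := lastu.
have eE := subsetP sHE _ eH.
have ce := cost_ge0 confH eE; rewrite /cost eH in ce.
have shx := inv_ge0 inv e.1; have sl0 := slack_ge0 e r.
rewrite /process_in; apply: raise_shift_inv => //;
  rewrite ?/source ?/target ?/cost eH // [slack e (rank st)]/slack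
    !(inv_rank inv) e2 uD; rewrite e2 in ce;
  case: ifPn => xD; rewrite ?xD.
- have := minu _ xD; lia.
- split=> //; lia.
- have := minu _ xD; lia.
- lia.
Qed.

(** * One iteration of the while loop, and termination *)

Lemma foldl_inv (f : relief_state V -> V * V -> relief_state V)
    (P : pred (V * V)) D u es A st :
    (forall B e st', relief_inv D (e :: B) st' -> last_popped D u st' -> P e ->
      relief_inv D B (f st' e) /\ last_popped D u (f st' e)) ->
    all P es -> relief_inv D (es ++ A) st -> last_popped D u st ->
  relief_inv D A (foldl f st es) /\ last_popped D u (foldl f st es).
Proof.
move=> fP; elim: es st => //= e es IH st /andP[Pe Pes] inv lastu.
by have [inv' lastu'] := fP _ _ _ inv lastu Pe; apply: IH.
Qed.

(** Popping [u] creates obligations only for the arcs leaving [u]. Those skipped by both inner loops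
    are already satisfied, because failing the selection test bounds the rank of their target; the
    others are the pending [es ++ fs]. *)
Lemma pop_inv D st u es fs :
    relief_inv D [::] st -> highest_priority st u ->
    perm_eq es (enum (out_edges E H (rank (pop st u)) u)) ->
    perm_eq fs (enum (in_edges H r (rank (pop st u)) u)) ->
  [/\ u \notin D, relief_inv (rcons D u) (es ++ fs) (pop st u)
    & last_popped (rcons D u) u (pop st u)].
Proof.
move=> inv [k qu qmax] /perm_mem esP /perm_mem fsP.
have [uD shu kE] : [/\ u \notin D, 0 < shift st u & k = shift st u].
  by move: qu; rewrite (inv_queue inv); case: ifP => // /andP[uD shu] [<-].
have minu v : v \notin D -> shift st v <= shift st u.
  move=> vD; have [shv|] := ltP 0 (shift st v); last lia.
  by rewrite -kE; apply: (qmax v); rewrite (inv_queue inv) vD shv.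
have memD v : (v \in rcons D u) = (v == u) || (v \in D).
  by rewrite mem_rcons inE.
have indexE v : v \in D -> index v (rcons D u) = index v D.
  by move=> vD; rewrite -cats1 index_cat vD.
have rankE v : rank (pop st u) v
    = r v + (if v \in rcons D u then shift st v else 0).
  rewrite /= memD; case: eqP => [->|_] /=; rewrite (inv_rank inv) //.
  by rewrite (negPf uD) addr0.
split=> //; last first.
  split; first by rewrite memD eqxx.
  move=> d; rewrite memD => /orP[/eqP->|dD] //=.
  exact: inv_sorted inv d u dD uD.
split=> //=.
- move=> v; rewrite memD; case: eqP => //= _; exact: inv_queue inv v.
- exact: inv_ge0 inv.
- exact: inv_root inv.
- exact: inv_le_root inv.
- move=> d v; rewrite !memD negb_or => /orP[/eqP-> /andP[_]|dD /andP[_]].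
    exact: minu.
  exact: inv_sorted inv d v dD.
- set rk := rank (pop st u) in esP fsP rankE.
  move=> e eE; rewrite mem_cat negb_or esP fsP !mem_enum memD.
  move=> /andP[outN inN].
  (* Only an inequality: an unpopped target may have a shift not yet added to its rank. *)
  have tle : rk (target e) <= r (target e) + shift st (target e).
    by rewrite rankE; have := inv_ge0 inv (target e); case: ifP; lia.
  have ru : rk u = r u + shift st u by rewrite rankE memD eqxx.
  case/orP=> [/eqP srce|eD]; last exact: (inv_arc inv eE).
  rewrite srce; move: tle srce outN inN; rewrite /source /target /cost !inE eE.
  case: ifPn => eH tle srce; rewrite srce eqxx /=; last first.
    move=> + _; rewrite -ltNge; lia.
  move=> _; rewrite -leNgt [slack e rk]/slack srce; lia.
- move=> v y e /(inv_parent inv)[eE srce tgte shv ltyv]; split=> //.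
  have yD : y \in D by rewrite -index_mem (leq_trans ltyv) // index_size.
  rewrite indexE //; have [vD|vD] := boolP (v \in D); first by rewrite indexE.
  by rewrite -cats1 index_cat (negPf vD) ltn_addr // index_mem.
- exact: inv_linked inv.
Qed.

Lemma relief_step_inv D st st' :
    relief_inv D [::] st -> relief_step E H r st st' ->
  exists2 u, u \notin D & relief_inv (rcons D u) [::] st'.
Proof.
move=> inv [u [es [fs [highu esP fsP ->]]]]; exists u.
  by have [] := pop_inv inv highu esP fsP.
have [_ inv1 last1] := pop_inv inv highu esP fsP.
have [inv2 last2] :
    relief_inv (rcons D u) fs (foldl (process_out u) (pop st u) es)
    /\ last_popped (rcons D u) u (foldl (process_out u) (pop st u) es).
  apply: (foldl_inv (P := [pred e | (e \in E :\: H) && (e.1 == u)])) => //.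
    by move=> B e st1 + + /andP[eEH /eqP]; move=> *; apply: process_out_inv.
  apply/allP=> e; rewrite (perm_mem esP) mem_enum [e \in out_edges _ _ _ _]inE.
  by case/and3P=> /= -> ->.
have [] // := @foldl_inv (process_in r u) [pred e | (e \in H) && (e.2 == u)]
  (rcons D u) u fs [::] (foldl (process_out u) (pop st u) es).
- by move=> B e st1 + + /andP[eH /eqP]; move=> *; apply: process_in_inv.
- apply/allP=> e; rewrite (perm_mem fsP) mem_enum [e \in in_edges _ _ _ _]inE.
  by case/and3P=> /= -> ->.
- by rewrite cats0.
Qed.

Lemma relief_loop_inv D st st' :
    relief_inv D [::] st -> relief_loop E H r st st' ->
  exists2 D', relief_inv D' [::] st' & forall v, queue st' v = None.
Proof.
move=> + loop.
elim: loop D => {st st'} [st qN|st st1 st2 step _ IH] D inv.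
  by exists D.
by have [u _ /IH] := relief_step_inv inv step.
Qed.

(** Each iteration pops a vertex outside [D], so the number of unpopped vertices decreases. *)
Lemma relief_loop_total D st :
  relief_inv D [::] st -> exists st', relief_loop E H r st st'.
Proof.
have [n] := ubnP #|[predC D]|; elim: n D st => // n IH D st ltDn inv.
case: (pickP (fun v => queue st v != None)) => [v0 qv0|qN]; last first.
  by exists st; constructor=> v; apply/eqP; have /negbFE := qN v.
pose u := [arg max_(v > v0 | queue st v != None) shift st v]%O.
have highu : highest_priority st u.
  rewrite /u; case: arg_maxP => // {}u qu umax.
  have qE v l : queue st v = Some l -> l = shift st v.
    by rewrite (inv_queue inv); case: ifP => // _ [].
  case qu': (queue st u) qu => [k|//] _; exists k => // v l qv.
  by rewrite (qE _ _ qu') (qE _ _ qv); apply: umax; rewrite qv.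
pose st1 := foldl (process_in r u)
  (foldl (process_out u) (pop st u) (enum (out_edges E H (rank (pop st u)) u)))
  (enum (in_edges H r (rank (pop st u)) u)).
have step : relief_step E H r st st1.
  exists u, (enum (out_edges E H (rank (pop st u)) u)),
    (enum (in_edges H r (rank (pop st u)) u)); split=> //; exact: perm_refl.
have [x xD inv1] := relief_step_inv inv step.
have [|st2 loop] := IH _ _ _ inv1; last first.
  by exists st2; apply: ReliefLoopStep step _.
rewrite -ltnS (leq_trans _ ltDn) // ltnS.
apply: proper_card; apply/properP; split.
  by apply/subsetP=> v; rewrite !inE mem_rcons inE negb_or => /andP[].
by exists x; rewrite !inE // mem_rcons inE eqxx.
Qed.

(** * The state at the end of the loop *)

Lemma relief_loop_out st :
    0 < slack (p, s) r -> relief_loop E H r (relief_init r p s) st ->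
  exists2 D, relief_inv D [::] st &
    (forall v, rank st v = r v + shift st v) /\
    (forall e, e \in E ->
      shift st (source e) - cost e <= shift st (target e)).
Proof.
move=> slack_ps loop.
have [D inv qN] := relief_loop_inv (relief_init_inv slack_ps) loop.
have shN v : v \notin D -> shift st v = 0.
  move=> vD; have := qN v; rewrite (inv_queue inv) vD /=.
  by have := inv_ge0 inv v; case: ltP => // ? ? _; lia.
exists D => //; split=> [v|e eE].
  by rewrite (inv_rank inv); case: ifPn => // /shN->.
have [eD|eD] := boolP (source e \in D); first exact: (inv_arc inv).
(* An unpopped source has shift 0 once the queue is empty, so its arc asks for nothing positive. *)
have := cost_ge0 confH eE; have := inv_ge0 inv (target e).
rewrite (shN _ eD); lia.
Qed.

(** Translation of arc inequalities back to ranks. The first two facts hold for all edges; the last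
    two, for tight arcs, serve the edges that enter or leave [H] when the path is flipped. *)
Lemma relief_edges st :
    (forall v, rank st v = r v + shift st v) ->
    (forall e, e \in E ->
      shift st (source e) - cost e <= shift st (target e)) ->
  [/\ forall e, e \in E :\: H -> ~~ backward (rank st) e,
      forall e, e \in H -> slack e (rank st) <= slack e r,
      forall e, e \in E :\: H ->
        shift st (source e) - cost e = shift st (target e) ->
        slack e (rank st) = 0
    & forall e, e \in H ->
        shift st (source e) - cost e = shift st (target e) ->
        ~~ backward (rank st) e].
Proof.
move=> rankE arc; split=> e.
- case/setDP=> eE eH; have := arc e eE.
  rewrite /source /target /cost (negPf eH) /backward !rankE; lia.
- move=> eH; have := arc e (subsetP sHE _ eH).
  rewrite /source /target /cost eH /slack !rankE; lia.
- case/setDP=> eE eH.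
  rewrite /source /target /cost (negPf eH) /slack !rankE; lia.
- move=> eH; have := slack_ge0 e r.
  rewrite /source /target /cost eH /backward !rankE; lia.
Qed.

End Residual.

(** * Rerouting, comparison of slacks, and conclusion *)

Lemma reroute_eulerian (V : finType) (H : {set V * V}) (p s : V)
    (par : V -> option (V * (V * V))) (h : V -> nat) (O : {set V * V}) :
    eulerian H -> (p, s) \in H ->
    (forall v y e, par v = Some (y, e) ->
      [/\ source H e = y, target H e = v & (h y < h v)%N]) ->
    parent_path par p s O ->
  eulerian ((H :\: O :|: O :\: H) :\ (p, s)).
Proof.
move=> eulH psH parP pathO; have [endO sumO] := sum_parent_path parP pathO.
(* As an edge of [H], [(p, s)] is traversed backwards into [p], which no path arc enters. *)
have psO : (p, s) \notin O.
  by apply/negP => /endO[]; rewrite /target psH eqxx.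
(* The flip adds [(p == v)%:R - (s == v)%:R] to the balance, which is the net flow of [(p, s)];
   deleting that edge cancels it. *)
apply/eulerianP => v; have := sum_flip H O (fun e => net e v).
rewrite (big_setD1 (p, s)) /=; last by rewrite !inE psO psH.
rewrite sumO (iffLR (eulerianP H) eulH) add0r => /(canRL (addKr _)) ->.
by rewrite addNr.
Qed.

Lemma le_max_slack (V : finType) (H H' : {set V * V}) (r r' : V -> int) :
    (forall e, e \in H' ->
      slack e r' = 0 \/ e \in H /\ slack e r' <= slack e r) ->
  max_slack H' r' <= max_slack H r.
Proof.
move=> le_slack; apply/bigmax_leP; split=> [|e /le_slack[->|[eH le_e]]].
- exact: bigmax_ge_id.
- exact: bigmax_ge_id.
- exact: le_trans le_e (le_bigmax_cond _ _ eH).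
Qed.

Lemma lt_num_slack (V : finType) (H H' : {set V * V}) (r r' : V -> int) e0 :
    (forall e, e \in H' ->
      slack e r' = 0 \/ e \in H /\ slack e r' <= slack e r) ->
    e0 \in H -> 0 < slack e0 r -> ~~ ((e0 \in H') && (0 < slack e0 r')) ->
  (num_slack H' r' < num_slack H r)%N.
Proof.
move=> le_slack e0H sl0 e0N; apply: proper_card; apply/properP.
split; last first.
  by exists e0; rewrite !inE ?e0H.
apply/subsetP=> e; rewrite !inE => /andP[/le_slack[->|[-> le_e]]].
  by rewrite ltxx.
by move=> /lt_le_trans; apply.
Qed.

(** Since [relief] is a relation, existence of an output is proved separately; the second part then
    covers every tie-breaking and enumeration order. *)
Theorem proposition3 (V : finType) (E H : {set V * V}) (r : V -> int) (p s : V)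
    (maxH : maximal_eulerian E H) (confH : conforms E H r)
    (ps_in_H : (p, s) \in H) (slack_ps : 0 < slack (p, s) r) :
  (exists (H' : {set V * V}) (r' : V -> int), relief E H r p s H' r') /\
  (forall (H' : {set V * V}) (r' : V -> int), relief E H r p s H' r' ->
    [/\ maximal_eulerian E H',
        conforms E H' r',
        max_slack H' r' <= max_slack H r
      & (num_slack H' r' < num_slack H r)%N]).
Proof.
have [sHE eulH _] := maxH; split.
  have [st loop] := relief_loop_total confH sHE (relief_init_inv E H slack_ps).
  have [D inv [rankE _]] := relief_loop_out confH sHE slack_ps loop.
  have [sl|slN] := boolP (0 < slack (p, s) (rank st)); last first.
    by exists H, (rank st); apply: ReliefKeep.
  have [|O pathO] := relief_parent_path confH (x := s) inv.
    (* The shift of [p] is the initial slack of [(p, s)], so the final slack of this edge equals the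
       shift of [s], which is therefore positive. *)
    by move: (inv_root inv) sl slack_ps; rewrite /slack /= !rankE; lia.
  by exists ((H :\: O :|: O :\: H) :\ (p, s)), (rank st); apply: ReliefReroute.
(* Both outcomes reduce to these conditions; the last one makes [(p, s)] the witness that the count
   drops strictly. *)
suff concl (H' : {set V * V}) (r' : V -> int) :
    H' \subset E -> eulerian H' -> conforms E H' r' ->
    (forall e, e \in H' ->
      slack e r' = 0 \/ e \in H /\ slack e r' <= slack e r) ->
    ~~ (((p, s) \in H') && (0 < slack (p, s) r')) ->
  [/\ maximal_eulerian E H', conforms E H' r', max_slack H' r' <= max_slack H r
    & (num_slack H' r' < num_slack H r)%N].
- move=> H' r' [st loop slN|st O loop sl pathO];
    have [D inv [rankE arc]] := relief_loop_out confH sHE slack_ps loop;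
    have [fwd leS tight0 tight_fwd] := relief_edges sHE rankE arc.
    apply: concl => //; last by rewrite negb_and slN orbT.
      by move=> e eE; apply: contraLR => eH; apply: fwd; rewrite inE eH.
    by move=> e eH; right; split=> //; apply: leS.
  have parP v y e : parent st v = Some (y, e) ->
      [/\ source H e = y, target H e = v & (index y D < index v D)%N].
    by case/(inv_parent inv).
  have tightO e : e \in O -> e \in E /\
      shift st (source H e) - cost H r e = shift st (target H e).
    have [endO _] := sum_parent_path parP pathO.
    by case/endO => _ [_ /(inv_parent inv)[]].
  apply: concl.
  + apply/subsetP => e; rewrite !inE => /andP[_ /orP[/andP[_]|/andP[_]]].
      exact: subsetP.
    by case/tightO.
  + exact: (reroute_eulerian (par := parent st) (h := index^~ D)).
  + move=> e eE; apply: contraLR; rewrite !inE negb_and negbK.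
    (* The deleted edge [(p, s)] is forward because its slack is still positive. *)
    case/orP=> [/eqP->|]; first by move: sl; rewrite /slack /backward /=; lia.
    have [eO|eO] := boolP (e \in O); have [eH|eH] := boolP (e \in H) => // _.
      by apply: tight_fwd => //; case: (tightO e eO).
    by apply: fwd; rewrite inE eH.
  + move=> e; rewrite !inE => /andP[_ /orP[/andP[_ eH]|/andP[eH eO]]].
      by right; split=> //; apply: leS.
    by left; case: (tightO e eO) => eE; apply: tight0; rewrite inE eH.
  + by rewrite !inE eqxx.
- move=> sH'E eulH' confH' leS psN; split=> //.
  + exact: conforms_maximal confH'.
  + exact: le_max_slack.
  + exact: lt_num_slack psN.
Qed.
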